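(* Let $G$ and $H$ be finite, simple, connected graphs such that $\mathbbm{1}$ is not in the image of the distance matrix of $G$ and $\mathbbm{1}$ is not in the image of the distance matrix of $H$. Then $\mathbbm{1}$ is not in the image of the distance matrix of the Cartesian product graph $G\times H$.
   Context: The distance matrix of a finite connected graph with vertices $v_1,\dots,v_n$ is the real $n\times n$ matrix with entries $D_{ij}=d(v_i,v_j)$ (shortest-path distance). $\mathbbm{1}$ is the all-ones column vector of the appropriate length. Given graphs $G=(V_1,E_1)$ and $H=(V_2,E_2)$, the Cartesian product $G\times H$ is the graph on vertex set $V_1\times V_2$ in which $(v_1,v_2)$ and $(v_1',v_2')$ are joined by an edge if and only if either $v_1=v_1'$ and $v_2$ is adjacent to $v_2'$ in $H$, or $v_2=v_2'$ and $v_1$ is adjacent to $v_1'$ in $G$. *)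

(* Defs.v *)
From HB Require Import structures.
From mathcomp Require Import all_boot all_order all_algebra.
From mathcomp Require Import reals.

Set Implicit Arguments.
Unset Strict Implicit.
Unset Printing Implicit Defensive.

Import GRing.Theory.
Local Open Scope ring_scope.

Record sgraph := SGraph {
  vertex :> finType;
  adj : rel vertex;
  adj_sym : symmetric adj;
  adj_irr : irreflexive adj }.

Definition connected_graph (G : sgraph) : Prop :=
  forall x y : G, connect (@adj G) x y.

Definition walk_of_length (G : sgraph) (x y : G) (n : nat) : bool :=
  [exists p : n.-tuple G, path (@adj G) x p && (last x p == y)].

(* The least length of a walk from x to y.  Searching the lengths below #|G|
   suffices, since a shortest walk repeats no vertex (see distP and dist_min);
   the value is the junk #|G| when y is not reachable from x. *)
Definition dist (G : sgraph) (x y : G) : nat :=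
  find (walk_of_length x y) (iota 0 #|G|).

Lemma distP (G : sgraph) (x y : G) :
  connect (@adj G) x y -> walk_of_length x y (dist x y).
Proof.
case/connectP=> p0 /shortenP[p pth Up _] ->.
have lt_p : (size p < #|G|)%N by have := max_card (mem (x :: p)); rewrite (card_uniqP Up).
have hasw : has (walk_of_length x (last x p)) (iota 0 #|G|).
  apply/hasP; exists (size p); first by rewrite mem_iota.
  by apply/existsP; exists (in_tuple p); rewrite pth eqxx.
have := nth_find 0%N hasw; rewrite nth_iota //.
by move: hasw; rewrite has_find size_iota.
Qed.

Lemma dist_min (G : sgraph) (x y : G) (n : nat) :
  walk_of_length x y n -> (dist x y <= n)%N.
Proof.
move=> wn; case: (ltnP n #|G|) => [lt_n | le_n]; last first.
  apply: leq_trans le_n; rewrite -[X in (_ <= X)%N](size_iota 0 #|G|).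
  exact: find_size.
rewrite leqNgt; apply/negP => lt_nd.
by have := before_find 0%N lt_nd; rewrite nth_iota // add0n wn.
Qed.

Definition dist_mx (R : realType) (G : sgraph) : 'M[R]_#|G| :=
  \matrix_(i, j) (dist (enum_val i) (enum_val j))%:R.

Definition in_image (R : realType) (m n : nat) (A : 'M[R]_(m, n))
    (v : 'cV[R]_m) : Prop :=
  exists x : 'cV[R]_n, A *m x = v.

Definition cart_adj (G H : sgraph) : rel (G * H) :=
  fun u v => ((u.1 == v.1) && adj u.2 v.2) || ((u.2 == v.2) && adj u.1 v.1).

Lemma cart_adj_sym (G H : sgraph) : symmetric (@cart_adj G H).
Proof.
by move=> u v; rewrite /cart_adj (eq_sym v.1) (eq_sym v.2) !(adj_sym v.1, adj_sym v.2).
Qed.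

Lemma cart_adj_irr (G H : sgraph) : irreflexive (@cart_adj G H).
Proof. by move=> u; rewrite /cart_adj !adj_irr !andbF. Qed.

Definition cart_prod (G H : sgraph) : sgraph :=
  SGraph (@cart_adj_sym G H) (@cart_adj_irr G H).

(* Main.v *)
Require Import Defs.
From HB Require Import structures.
From mathcomp Require Import all_boot all_order all_algebra.
From mathcomp Require Import reals.

(** By duality, the all-ones vector misses the image of a matrix exactly when
    some vector of its left kernel has nonzero coordinate sum
    ([not_in_imageP], [ones_not_in_imageP]).  Distances in a Cartesian product
    add up coordinatewise ([dist_cart_prod]), so if [a] and [b] are such weight
    functions on [G] and [H], then [a x * b y] is one on the product: its
    pairing with [d(x, x') + d(y, y')] is
      [(sum_x a x * d(x, x')) * (sum_y b y)
       + (sum_x a x) * (sum_y b y * d(y, y')) = 0],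
    while its total is the product of the totals of [a] and [b]. *)

Set Implicit Arguments.
Unset Strict Implicit.
Unset Printing Implicit Defensive.

Import GRing.Theory.
Local Open Scope ring_scope.

Lemma walkP (G : sgraph) (x y : G) (n : nat) :
  reflect (exists p : seq G, [/\ path (@adj G) x p, last x p = y & size p = n])
          (walk_of_length x y n).
Proof.
apply: (iffP existsP) => [[p /andP[pth /eqP ly]] | [p [pth ly /eqP sz]]].
  by exists p; rewrite pth ly size_tuple.
by exists (Tuple sz); rewrite /= pth ly eqxx.
Qed.

Lemma walk_cons (G : sgraph) (x y z : G) (n : nat) :
  adj x y -> walk_of_length y z n -> walk_of_length x z n.+1.
Proof.
by move=> xy /walkP[p [pth lz sz]]; apply/walkP; exists (y :: p); rewrite /= xy pth lz sz.
Qed.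

Lemma walk_cat (G : sgraph) (x y z : G) (m n : nat) :
  walk_of_length x y m -> walk_of_length y z n -> walk_of_length x z (m + n).
Proof.
move=> /walkP[p [pthp lp <-]] /walkP[q [pthq lq <-]]; apply/walkP.
by exists (p ++ q); rewrite cat_path last_cat size_cat pthp lp pthq lq.
Qed.

Lemma walk_map (G H : sgraph) (f : G -> H) (x y : G) (n : nat) :
    {homo f : u v / adj u v} ->
  walk_of_length x y n -> walk_of_length (f x) (f y) n.
Proof.
move=> fadj /walkP[p [pth <- <-]]; apply/walkP.
by exists (map f p); rewrite last_map size_map; split=> //; apply: homo_path pth.
Qed.

(** Each step of a walk in the product moves exactly one coordinate, so sorting
    the steps by the coordinate they move splits it into walks in the factors. *)
Lemma walk_cart_prod_split (G H : sgraph) (u v : cart_prod G H) (n : nat) :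
    walk_of_length u v n ->
  exists i j, [/\ walk_of_length u.1 v.1 i, walk_of_length u.2 v.2 j
                & (i + j)%N = n].
Proof.
case/walkP=> p [pth <- <-] {v n}.
elim: p u pth => [|w p IHp] u /=.
  by move=> _; exists 0%N, 0%N; split=> //; apply/walkP; exists [::].
case/andP=> uw /IHp[i [j [wi wj <-]]].
case/orP: uw => /andP[/eqP e a].
  by exists i, j.+1; rewrite e addnS; split=> //; apply: walk_cons wj.
by exists i.+1, j; rewrite e addSn; split=> //; apply: walk_cons wi.
Qed.

(** Upper bound: move along the first factor, then along the second.  Lower
    bound: a shortest walk of the product splits into walks in the factors. *)
Lemma dist_cart_prod (G H : sgraph) (u v : cart_prod G H) :
    connected_graph G -> connected_graph H ->
  dist u v = (dist u.1 v.1 + dist u.2 v.2)%N.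
Proof.
case: u v => [x y] [x' y'] connG connH /=.
have wuv : @walk_of_length (cart_prod G H) (x, y) (x', y') (dist x x' + dist y y').
  apply: (@walk_cat (cart_prod G H) _ (x', y)).
    apply: (@walk_map G (cart_prod G H) (fun g => (g, y))); last exact: distP.
    by move=> g g' a; rewrite /= /cart_adj /= eqxx a orbT.
  apply: (@walk_map H (cart_prod G H) (fun h => (x', h))); last exact: distP.
  by move=> h h' a; rewrite /= /cart_adj /= eqxx a.
apply/eqP; rewrite eqn_leq dist_min //=.
have /walk_cart_prod_split[i [j [wi wj <-]]] :
    @walk_of_length (cart_prod G H) (x, y) (x', y') (@dist (cart_prod G H) (x, y) (x', y')).
  apply: distP; case/walkP: wuv => p [pth lp _].
  by apply/connectP; exists p.
by apply: leq_add; apply: dist_min.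
Qed.

(** The Fredholm alternative: the transposed columns of [cokermx A^T] span the
    left kernel of [A], and [v] is in the column space of [A] exactly when they
    all annihilate it. *)
Lemma not_in_imageP (R : realType) (m n : nat) (A : 'M[R]_(m, n)) (v : 'cV[R]_m) :
  ~ in_image A v <-> exists2 u : 'rV[R]_m, u *m A = 0 & u *m v != 0.
Proof.
split=> [nAv | [u uA uv] [x Ax]]; last by rewrite -Ax mulmxA uA mul0mx eqxx in uv.
have : ~~ (v^T <= A^T)%MS.
  apply/negP => /submxP[x vx]; apply: nAv; exists x^T.
  by apply: trmx_inj; rewrite trmx_mul trmxK.
rewrite submxE => /matrix0Pn[i [j nz]].
exists (col j (cokermx A^T))^T.
  by apply: trmx_inj; rewrite trmx_mul trmxK colE mulmxA mulmx_coker mul0mx trmx0.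
rewrite -(trmxK v) -trmx_mul colE mulmxA -colE; apply: contraNneq nz => /matrixP/(_ 0 i).
by rewrite !mxE => ->.
Qed.

Lemma ones_not_in_imageP (R : realType) (G : sgraph) :
  ~ in_image (dist_mx R G) (const_mx 1) <->
  exists2 a : G -> R, (forall y, \sum_x a x * (dist x y)%:R = 0)
                    & \sum_x a x != 0.
Proof.
rewrite not_in_imageP; split=> [[u uD u1] | [a aD a1]].
  exists (fun x => u 0 (enum_rank x)) => [y|].
    have /matrixP/(_ 0 (enum_rank y)) := uD; rewrite !mxE => uDy.
    rewrite big_enum_val -[RHS]uDy; apply: eq_bigr => i _.
    by rewrite !mxE enum_valK enum_rankK.
  apply: contraNneq u1 => u1; apply/eqP/matrixP=> i j; rewrite !mxE -[RHS]u1.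
  rewrite [RHS]big_enum_val; apply: eq_bigr => k _.
  by rewrite mxE mulr1 enum_valK (ord1 i).
exists (\row_i a (enum_val i)).
  apply/matrixP=> i j; rewrite !mxE -[RHS](aD (enum_val j)) [RHS]big_enum_val.
  by apply: eq_bigr => k _; rewrite !mxE.
apply: contraNneq a1 => /matrixP/(_ 0 0); rewrite !mxE => a1.
rewrite big_enum_val -[X in _ == X]a1; apply/eqP/eq_bigr => k _.
by rewrite !mxE mulr1.
Qed.

Theorem theorem6 (R : realType) (G H : sgraph)
  (connG : connected_graph G) (connH : connected_graph H)
  (hG : ~ in_image (dist_mx R G) (const_mx 1))
  (hH : ~ in_image (dist_mx R H) (const_mx 1)) :
  ~ in_image (dist_mx R (cart_prod G H)) (const_mx 1).
Proof.
have [a aD a1] := (ones_not_in_imageP R G).1 hG.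
have [b bD b1] := (ones_not_in_imageP R H).1 hH.
apply/ones_not_in_imageP; exists (fun u : cart_prod G H => a u.1 * b u.2) => [v|].
  under eq_bigr => u _.
    rewrite (dist_cart_prod u v connG connH) natrD mulrDr mulrAC -[X in _ + X]mulrA.
    over.
  rewrite big_split /=.
  rewrite -(pair_bigA _ (fun x y => a x * (dist x v.1)%:R * b y)) /=.
  rewrite -(pair_bigA _ (fun x y => a x * (b y * (dist y v.2)%:R))) /=.
  by rewrite -!big_distrlr /= aD bD mul0r mulr0 addr0.
rewrite -(pair_bigA _ (fun x y => a x * b y)) -big_distrlr /=.
by rewrite mulf_neq0.
Qed.
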